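(* Let $\ell \ge k \ge 2$ be integers. Then for all integers $n \ge k+\ell$, $$\mathrm{sat}^*(n,K_{k,\ell})\le \left(k-1+\frac{(k(k-1)+1)(\ell-1)}{2}\right)n-\frac{(k(k-1)^2+1)(\ell-1)+k(k-1)}{2}.$$
   Context: All graphs are finite and simple; $K_{k,\ell}$ is the complete bipartite graph with parts of sizes $k$ and $\ell$. An edge-colouring of a graph is proper if incident edges receive different colours, and a subgraph is rainbow if all of its edges receive pairwise distinct colours. A graph $G$ is properly rainbow $H$-saturated if (1) there is a proper edge-colouring of $G$ (with any set of colours) containing no rainbow copy of $H$, and (2) for every edge $e$ of the complement $\overline{G}$, every proper edge-colouring of $G+e$ contains a rainbow copy of $H$. The proper rainbow saturation number $\mathrm{sat}^*(n,H)$ is the minimum number of edges in an $n$-vertex properly rainbow $H$-saturated graph. *)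

(* Defs.v *)
From HB Require Import structures.
From mathcomp Require Import all_boot all_order all_algebra.
From mathcomp Require Import boolp.

Set Implicit Arguments.
Unset Strict Implicit.
Unset Printing Implicit Defensive.

(* A simple graph on a finite vertex type is given by its set of
   edges, an edge being a two-element set of vertices. *)
Record sgraph (V : finType) := SGraph {
  edges : {set {set V}};
  _ : [forall e in edges, #|e| == 2]
}.

HB.instance Definition _ (V : finType) := [isSub for @edges V].
HB.instance Definition _ (V : finType) := [Finite of sgraph V by <:].

Lemma card_edge (V : finType) (G : sgraph V) (e : {set V}) :
  e \in edges G -> #|e| = 2.
Proof. by case: G => E /= /forall_inP hE /hE /eqP. Qed.

Lemma graph_of_subproof (V : finType) (A : {set {set V}}) :
  [forall e in [set e in A | #|e| == 2], #|e| == 2].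
Proof. by apply/forall_inP => e; rewrite inE => /andP[]. Qed.

Definition graph_of (V : finType) (A : {set {set V}}) : sgraph V :=
  SGraph (graph_of_subproof A).

Lemma in_graph_of (V : finType) (A : {set {set V}}) (e : {set V}) :
  (e \in edges (graph_of A)) = (e \in A) && (#|e| == 2).
Proof. by rewrite inE. Qed.

Definition complete_graph (V : finType) : sgraph V := graph_of [set: {set V}].

Definition compl_graph (V : finType) (G : sgraph V) : sgraph V :=
  graph_of (~: edges G).

Definition add_edge (V : finType) (G : sgraph V) (e : {set V}) : sgraph V :=
  graph_of (e |: edges G).

Definition complete_bipartite (k l : nat) : sgraph ('I_k + 'I_l)%type :=
  graph_of [set [set inl i; inr j] | i : 'I_k, j : 'I_l].

Lemma complete_bipartiteE (k l : nat) :
  edges (complete_bipartite k l) =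
  [set [set inl i; inr j] | i : 'I_k, j : 'I_l].
Proof.
apply/setP => e; rewrite in_graph_of andb_idr //.
by case/imset2P => i j _ _ ->; rewrite cards2.
Qed.

(* A colouring is a function on all vertex sets; only its values on the edges
   of the graph are ever used. *)
Definition proper_coloring (V : finType) (G : sgraph V) (C : Type)
    (c : {set V} -> C) : Prop :=
  forall e f : {set V}, e \in edges G -> f \in edges G ->
    e != f -> e :&: f != set0 -> c e <> c f.

(* A copy of H in G is an injective map on vertices sending edges to edges;
   the edges of the copy are the images f @: e of the edges e of H. *)
Definition is_copy (W V : finType) (H : sgraph W) (G : sgraph V)
    (f : W -> V) : Prop :=
  injective f /\ forall e : {set W}, e \in edges H -> f @: e \in edges G.

Definition has_rainbow_copy (W V : finType) (H : sgraph W) (G : sgraph V)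
    (C : Type) (c : {set V} -> C) : Prop :=
  exists f : W -> V, is_copy H G f /\
    {in edges H &, injective (fun e : {set W} => c (f @: e))}.

Definition has_rainbow_free_coloring (W V : finType) (H : sgraph W)
    (G : sgraph V) : Prop :=
  exists (C : Type) (c : {set V} -> C),
    proper_coloring G c /\ ~ has_rainbow_copy H G c.

Definition rainbow_saturated (W V : finType) (H : sgraph W)
    (G : sgraph V) : Prop :=
  has_rainbow_free_coloring H G /\
  forall e : {set V}, e \in edges (compl_graph G) ->
    forall (C : Type) (c : {set V} -> C),
      proper_coloring (add_edge G e) c -> has_rainbow_copy H (add_edge G e) c.

(* The default value of the arg min is irrelevant as soon as H has an edge:
   see sat_starP. *)
Definition sat_star (n : nat) (W : finType) (H : sgraph W) : nat :=
  #|edges [arg min_(G < complete_graph 'I_n | `[< rainbow_saturated H G >])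
             #|edges G| ]|.

Lemma rainbow_saturated_exists (W V : finType) (H : sgraph W) :
  edges H != set0 -> exists G : sgraph V, rainbow_saturated H G.
Proof.
case/set0Pn => e0 He0.
pose P (G : sgraph V) := `[< has_rainbow_free_coloring H G >].
have P0 : P (graph_of set0).
  apply/asboolP; exists bool, (fun=> true); split.
    by move=> e f; rewrite in_graph_of inE.
  by case=> f [[_ /(_ _ He0)]]; rewrite in_graph_of inE.
case: (arg_maxnP (fun G => #|edges G|) P0) => G /asboolP PG maxG.
exists G; split=> // e; rewrite in_graph_of inE => /andP[eG e2] C c cP.
apply: contrapT => cH.
have /maxG : P (add_edge G e) by apply/asboolP; exists C, c.
have -> : edges (add_edge G e) = e |: edges G.
  apply/setP => f; rewrite in_graph_of andb_idr // !inE.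
  by case/orP => [/eqP -> //|/card_edge ->].
by rewrite cardsU1 eG /= ltnn.
Qed.

Lemma sat_starP (n : nat) (W : finType) (H : sgraph W) : edges H != set0 ->
  (exists2 G : sgraph 'I_n, rainbow_saturated H G
     & #|edges G| = sat_star n H) /\
  (forall G : sgraph 'I_n, rainbow_saturated H G ->
     sat_star n H <= #|edges G|).
Proof.
move=> H0; rewrite /sat_star /arg_min /extremum; case: pickP => [G|none].
  case/andP=> /asboolP GP /forall_inP Gmin; split; first by exists G.
  by move=> G' /asboolP /Gmin.
have [G1 /asboolP G1P] := rainbow_saturated_exists 'I_n H0.
pose P (G : sgraph 'I_n) := `[< rainbow_saturated H G >].
case: (@arg_minnP _ G1 P (fun G => #|edges G|) G1P) => G GP Gmin.
have := none G; rewrite /= -/(P G) GP /= => /forall_inP[] G' /Gmin; exact.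
Qed.

(* Main.v *)
Require Import Defs.
From mathcomp Require Import all_boot all_order all_algebra.
From mathcomp Require Import boolp zify lra.

(** Let [K] be a set of [k - 1] vertices. The graph of all pairs meeting [K]
    contains no [K_{k,l}], whose matching number is [k]; extend it by edges to
    a rainbow saturated graph [G]. If a vertex [v] outside [K] had more than
    [(k (k - 1) + 1) (l - 1)] neighbours outside [K], then [v |: K] and these
    neighbours would span a complete bipartite graph; since the star from a
    neighbour to [v |: K] shares a colour with at most [k (k - 1)] other such
    stars, some [l] of these stars are pairwise colour-disjoint and form a
    rainbow [K_{k,l}]. The bound follows by summing the degrees. *)

Set Implicit Arguments.
Unset Strict Implicit.

Import Order.TTheory GRing.Theory Num.Theory.

(** Take [G] with the most edges among the supergraphs of [G0] that admit a rainbow-free proper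
    colouring. A rainbow-free proper colouring of [G + e] would contradict this maximality. *)
Lemma rainbow_saturated_extension (W V : finType) (H : sgraph W)
    (G0 : sgraph V) : has_rainbow_free_coloring H G0 ->
  exists2 G : sgraph V, rainbow_saturated H G & edges G0 \subset edges G.
Proof.
move=> H0.
pose P (G : sgraph V) :=
  (edges G0 \subset edges G) && `[< has_rainbow_free_coloring H G >].
have P0 : P G0 by rewrite /P subxx; apply/asboolP.
case: (arg_maxnP (fun G => #|edges G|) P0) => G /andP[sG /asboolP PG] maxG.
exists G => //; split=> // e; rewrite in_graph_of inE => /andP[eG e2] C c cP.
apply: contrapT => cH.
have eE : edges (add_edge G e) = e |: edges G.
  apply/setP => f; rewrite in_graph_of andb_idr // !inE.
  by case/orP => [/eqP -> //|/card_edge ->].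
have /maxG : P (add_edge G e).
  apply/andP; split; last by apply/asboolP; exists C, c.
  by rewrite eE (subset_trans sG) ?subsetUr.
by rewrite eE cardsU1 eG /= ltnn.
Qed.

Lemma edge_neq (V : finType) (G : sgraph V) (x y : V) :
  [set x; y] \in edges G -> x != y.
Proof. by move/card_edge; rewrite cards2; case: (x =P y). Qed.

Lemma leq_card_bigcup (I T : finType) (P : pred I) (F : I -> {set T}) :
  #|\bigcup_(i | P i) F i| <= \sum_(i | P i) #|F i|.
Proof.
elim/big_rec2: _ => [|i m U _ Um]; first by rewrite cards0.
by apply: leq_trans (leq_card_setU _ _) _; rewrite leq_add2l.
Qed.

(** A largest [r]-independent subset [S] of [A] dominates [A], since an element related to nothing
    in [S] could be added. Hence [#|A| <= D * #|S|], which rules out [#|S| < l]; [g] lists the first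
    [l] elements of [S]. *)
Lemma exists_independent_set (T : finType) (r : rel T) (A : {set T})
    (D l : nat) : symmetric r -> reflexive r ->
  {in A, forall x, #|[set y in A | r x y]| <= D} -> D * l.-1 < #|A| ->
  exists g : 'I_l -> T, [/\ injective g, forall i, g i \in A &
    forall i j, r (g i) (g j) -> i = j].
Proof.
move=> rC rR rD Al.
pose P (S : {set T}) :=
  (S \subset A) && [forall x in S, forall y in S, r x y ==> (x == y)].
have P0 : P set0.
  by rewrite /P sub0set; apply/forall_inP => x; rewrite inE.
case: (arg_maxnP (fun S : {set T} => #|S|) P0) => S /andP[sSA /forall_inP SP] maxS.
have A_cover : A \subset \bigcup_(x in S) [set y in A | r x y].
  apply/subsetP => z zA; apply/bigcupP.
  have [zS|zS] := boolP (z \in S); first by exists z => //; rewrite inE zA rR.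
  have [/exists_inP[x xS rxz]|/exists_inPn nr] := boolP [exists x in S, r x z].
    by exists x => //; rewrite inE zA.
  have /maxS : P (z |: S).
    apply/andP; split; first by rewrite subUset sub1set zA.
    apply/forall_inP => x; rewrite in_setU1 => xzS.
    apply/forall_inP => y; rewrite in_setU1 => yzS; apply/implyP => rxy.
    case/orP: xzS => [/eqP xz|xS]; case/orP: yzS => [/eqP yz|yS].
    - by rewrite xz yz.
    - by move: (nr _ yS); rewrite rC -xz rxy.
    - by move: (nr _ xS); rewrite -yz rxy.
    - by move/forall_inP/(_ _ yS)/implyP: (SP _ xS); apply.
  by rewrite cardsU1 zS /= ltnn.
have lS : l <= #|S|.
  rewrite leqNgt; apply/negP => Sl.
  have : #|A| <= \sum_(x in S) D.
    apply: leq_trans (subset_leq_card A_cover) _.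
    rewrite (leq_trans (leq_card_bigcup _ _))//.
    by apply: leq_sum => x xS; apply: rD; apply: (subsetP sSA).
  rewrite sum_nat_const; nia.
exists (fun i => enum_val (widen_ord lS i)); split.
- by move=> i j /enum_val_inj /(congr1 val) /= ij; apply: val_inj.
- by move=> i; apply: (subsetP sSA); apply: enum_valP.
move=> i j rij.
have := SP _ (enum_valP (widen_ord lS i)).
move/forall_inP/(_ _ (enum_valP (widen_ord lS j)))/implyP/(_ rij)/eqP.
by move/enum_val_inj/(congr1 val) => /= ij; apply: val_inj.
Qed.

Lemma rainbow_copy_of_common_neighbours (V : finType) (G : sgraph V)
    (C : Type) (c : {set V} -> C) (k l : nat) (g : 'I_k -> V) (A : {set V}) :
  proper_coloring G c -> injective g ->
  (forall i a, a \in A -> [set g i; a] \in edges G) ->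
  (k * k.-1 + 1) * l.-1 < #|A| ->
  has_rainbow_copy (complete_bipartite k l) G c.
Proof.
move=> cP g_inj gA Al.
have c_inj (x y z : V) : [set x; y] \in edges G -> [set x; z] \in edges G ->
    c [set x; y] = c [set x; z] -> y = z.
  move=> xy xz cE; apply: contrapT => /eqP yz.
  apply: (cP _ _ xy xz _ _ cE).
    apply: contra_neq yz => /setP/(_ y).
    rewrite !inE eqxx orbT eq_sym (negPf (edge_neq xy)).
    by move/esym/eqP.
  by apply/set0Pn; exists x; rewrite !inE eqxx.
(* The conflict relation: the stars from [x] and from [y] to the image of [g] share a colour. The
   disjunct [x == y] keeps it reflexive even when [k = 0]. *)
pose r (x y : V) := (x == y) ||
  [exists i, exists j, `[< c [set g i; x] = c [set g j; y] >]].
have rC : symmetric r.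
  have rS x y : r x y -> r y x.
    case/orP => [/eqP->|/existsP[i /existsP[j /asboolP cij]]].
      by rewrite /r eqxx.
    apply/orP; right; apply/existsP; exists j; apply/existsP; exists i.
    exact/asboolP.
  by move=> x y; apply/idP/idP; apply: rS.
have rD : {in A, forall x, #|[set y in A | r x y]| <= k * k.-1 + 1}.
  move=> x xA.
  pose F i j := [set y in A | `[< c [set g i; x] = c [set g j; y] >]].
  have F1 i j : #|F i j| <= 1.
    apply/card_le1_eqP => y z; rewrite !inE.
    case/andP=> yA /asboolP cy /andP[zA /asboolP cz].
    by apply: (c_inj (g j)); rewrite ?gA // -cy -cz.
  have sub : [set y in A | r x y] \subset
      x |: \bigcup_(i < k) \bigcup_(j < k.-1) F i (lift i j).
    apply/subsetP => y; rewrite !inE => /andP[yA /orP[/eqP->|]].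
      by rewrite eqxx.
    case/existsP => i /existsP[j /asboolP cij].
    (* For [j = i] both edges contain [g i], so properness forces [y = x]. Only the [k * k.-1]
       ordered pairs with [j != i] remain, [lift i] enumerating these [j], and each pair allows at
       most one [y]; the extra 1 counts [x] itself. *)
    case: (unliftP i j) cij => [j' ->|->] cij; last first.
      by rewrite (c_inj _ _ _ (gA i x xA) (gA i y yA) cij) eqxx.
    apply/orP; right; apply/bigcupP; exists i => //.
    by apply/bigcupP; exists j' => //; rewrite inE yA; apply/asboolP.
  apply: leq_trans (subset_leq_card sub) _.
  rewrite cardsU1 addnC leq_add ?leq_b1 //.
  apply: leq_trans (leq_card_bigcup _ _) _.
  rewrite -[k in k * _]card_ord -sum_nat_const.
  apply: leq_sum => i _; apply: leq_trans (leq_card_bigcup _ _) _.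
  by rewrite -[leqRHS]card_ord -sum1_card; apply: leq_sum => j _; apply: F1.
have [h [h_inj hA hr]] := exists_independent_set rC
  (fun x => introT orP (or_introl (eqxx x))) rD Al.
pose f (w : 'I_k + 'I_l) := match w with inl i => g i | inr j => h j end.
have fE i j : f @: [set inl i; inr j] = [set g i; h j].
  by rewrite imsetU1 imset_set1.
exists f; split; first split.
- have gh i j : g i <> h j by apply/eqP/(@edge_neq _ G); apply: gA.
  move=> [i|i] [j|j] /=; first by move/g_inj->.
  + by move/gh.
  + by move/esym/gh.
  + by move/h_inj->.
- move=> e; rewrite complete_bipartiteE => /imset2P[i j _ _ ->].
  by rewrite fE gA.
move=> e e'; rewrite complete_bipartiteE.
case/imset2P=> i j _ _ -> /imset2P[i' j' _ _ ->]; rewrite !fE => cE.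
(* Edges of equal colour lie in conflicting stars, hence in the same star; there properness at the
   centre [h j] identifies them. *)
have jj' : j = j'.
  apply: hr; apply/orP; right; apply/existsP; exists i.
  by apply/existsP; exists i'; apply/asboolP.
subst j'; congr [set inl _; _]; apply: g_inj.
by apply: (c_inj (h j)); rewrite ![[set h j; _]]setUC ?gA.
Qed.

(** The complete split graph: a clique on [K] joined to an independent set on the remaining
    vertices. *)
Definition meeting_graph (V : finType) (K : {set V}) : sgraph V :=
  graph_of [set e | e :&: K != set0].

Lemma meeting_graph_rainbow_free (V : finType) (K : {set V}) (k l : nat) :
  #|K| < k -> k <= l ->
  has_rainbow_free_coloring (complete_bipartite k l) (meeting_graph K).
Proof.
(* Giving each edge its own colour is enough, because the graph contains no copy at all, rainbow or
   not. *)
move=> Kk kl; exists {set V}, id; split; first by move=> e f _ _ /eqP.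
case=> f [[f_inj fE] _].
(* The copy contains a matching of [k] edges, the [i]-th joining the images of [inl i] and [inr i].
   Each meets [K], and [g i] selects an end in [K]; disjointness makes [g] injective, so [K] would
   have at least [k] elements. *)
pose g (i : 'I_k) :=
  if f (inl i) \in K then f (inl i) else f (inr (widen_ord kl i)).
have gK i : g i \in K.
  rewrite /g; case: ifPn => // fi.
  have : f @: [set inl i; inr (widen_ord kl i)] \in
      edges (meeting_graph K).
    by apply: fE; rewrite complete_bipartiteE; apply: imset2_f.
  rewrite in_graph_of inE imsetU1 imset_set1 => /andP[/set0Pn[x]] + _.
  by rewrite !inE => /andP[/orP[]/eqP-> //]; rewrite (negPf fi).
have g_inj : injective g.
  move=> i j; rewrite /g; case: ifP => _; case: ifP => _ /f_inj //.
    by case.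
  by case=> ij; apply: val_inj.
have := subset_leq_card (_ : g @: setT \subset K).
rewrite card_imset // cardsT card_ord leqNgt Kk => /(_ _)/negP; apply=> //.
by apply/subsetP => _ /imsetP[i _ ->].
Qed.

Lemma handshake (V : finType) (G : sgraph V) :
  #|edges G|.*2 <= \sum_v #|[set u | [set v; u] \in edges G]|.
Proof.
have -> : #|edges G|.*2 = \sum_v #|[set e in edges G | v \in e]|.
  transitivity (\sum_(e in edges G) \sum_(v in e) 1).
    rewrite -muln2 -sum_nat_const; apply: eq_bigr => e /card_edge e2.
    by rewrite sum1_card e2.
  rewrite (exchange_big_dep predT) //=; apply: eq_bigr => v _.
  by rewrite -sum1_card; apply: eq_bigl => e; rewrite inE.
apply: leq_sum => v _.
(* Every edge at [v] is [[set v; u]] for some neighbour [u], so there are at least as many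
   neighbours as edges at [v]. *)
apply: leq_trans (leq_imset_card (fun u => [set v; u]) _).
apply/subset_leq_card/subsetP => e; rewrite inE => /andP[eG ve].
have /eqP/cards2P[x [y [xy eE]]] := card_edge eG.
move: ve; rewrite eE !inE => /orP[]/eqP vE; apply/imsetP.
  by exists y; rewrite ?inE vE -?eE.
by exists x; rewrite ?inE vE [[set y; x]]setUC -?eE.
Qed.

Lemma card_edges_le (V : finType) (G : sgraph V) (K : {set V}) (d : nat) :
  {in ~: K, forall v, #|[set u | [set v; u] \in edges G] :\: K| <= d} ->
  #|edges G|.*2 <= #|K| * #|V|.-1 + #|~: K| * (#|K| + d).
Proof.
move=> Kd; apply: leq_trans (handshake G) _.
rewrite (bigID (mem K)) /=; apply: leq_add.
  rewrite -sum_nat_const; apply: leq_sum => v _.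
  rewrite -(cardsC1 v); apply/subset_leq_card/subsetP => u.
  by rewrite !inE eq_sym; apply: edge_neq.
rewrite -sum_nat_const [leqRHS](eq_bigl (fun v => v \notin K)) => [|v]; last first.
  by rewrite inE.
apply: leq_sum => v vK; rewrite -(cardsID K [set u | _]); apply: leq_add; last first.
  by apply: Kd; rewrite inE.
by rewrite subset_leq_card ?subsetIr.
Qed.

(** The [k] vertices of [v |: K] are all adjacent to every neighbour of [v] outside [K]: [v] by
    choice, and [K] through the meeting graph. Too many such neighbours would force a rainbow copy
    in the given colouring. *)
Lemma saturated_extension_degree (V : finType) (G : sgraph V) (K : {set V})
    (k l : nat) (v : V) :
  has_rainbow_free_coloring (complete_bipartite k l) G ->
  edges (meeting_graph K) \subset edges G -> #|K|.+1 = k -> v \notin K ->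
  #|[set u | [set v; u] \in edges G] :\: K| <= (k * k.-1 + 1) * l.-1.
Proof.
move=> [C [c [cP nc]]] sG Kk vK; rewrite leqNgt; apply/negP => big.
have XE : k = #|v |: K| by rewrite cardsU1 vK.
apply: nc; apply: (@rainbow_copy_of_common_neighbours _ _ _ _ _ _
  (fun i => enum_val (cast_ord XE i)) _ cP _ _ big).
  by move=> i j /enum_val_inj/cast_ord_inj.
move=> i a; rewrite !inE => /andP[aK va].
move: (enum_valP (cast_ord XE i)); rewrite in_setU1 => /orP[/eqP->//|xK].
apply: (subsetP sG); rewrite in_graph_of inE cards2; apply/andP; split.
  by apply/set0Pn; exists (enum_val (cast_ord XE i)); rewrite !inE eqxx xK.
suff -> : enum_val (cast_ord XE i) != a by [].
by apply: contraNneq aK => <-.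
Qed.

Unset Implicit Arguments.
Local Open Scope ring_scope.

Theorem theorem1p4 (k l : nat) (hk : (2 <= k)%N) (hkl : (k <= l)%N)
    (n : nat) (hn : (k + l <= n)%N) :
  (sat_star n (complete_bipartite k l))%:R <=
    (k%:R - 1 + (k%:R * (k%:R - 1) + 1) * (l%:R - 1) / 2) * n%:R
    - ((k%:R * (k%:R - 1) ^+ 2 + 1) * (l%:R - 1) + k%:R * (k%:R - 1)) / 2
    :> rat.
Proof.
have kn : (k.-1 <= n)%N by lia.
pose K : {set 'I_n} := [set widen_ord kn i | i : 'I_k.-1].
have cK : #|K| = k.-1.
  rewrite card_imset ?card_ord // => i j /(congr1 val) ij.
  exact: val_inj.
have Kk : #|K|.+1 = k by rewrite cK; lia.
have [|G Gsat sG] := @rainbow_saturated_extension _ _ (complete_bipartite k l)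
  (meeting_graph K).
  by apply: meeting_graph_rainbow_free; rewrite ?Kk.
have H0 : edges (complete_bipartite k l) != set0.
  have k0 : (0 < k)%N by lia.
  have l0 : (0 < l)%N by lia.
  apply/set0Pn; exists [set inl (Ordinal k0); inr (Ordinal l0)].
  by rewrite complete_bipartiteE; apply: imset2_f.
have satG := (sat_starP n H0).2 G Gsat.
have := @card_edges_le _ G K ((k * k.-1 + 1) * l.-1).
have cKC : #|~: K| = (n - k.-1)%N by rewrite cardsCs setCK card_ord cK.
rewrite cKC cK card_ord => edgesG.
have /edgesG {}edgesG : {in ~: K, forall v,
    (#|[set u | [set v; u] \in edges G] :\: K| <= (k * k.-1 + 1) * l.-1)%N}.
  move=> v; rewrite inE => vK.
  by apply: saturated_extension_degree => //; case: Gsat.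
have {edgesG satG} : ((sat_star n (complete_bipartite k l)).*2 <=
    k.-1 * n.-1 + (n - k.-1) * (k.-1 + (k * k.-1 + 1) * l.-1))%N.
  by apply: leq_trans edgesG; rewrite leq_double.
move: (sat_star _ _) => s sle.
(* These substitutions remove all truncated subtractions; [m] is the number of vertices outside
   [K]. *)
have [a ka] : exists a, k = a.+2 by exists k.-2; lia.
have [b lb] : exists b, l = b.+1 by exists l.-1; lia.
have [m nm] : exists m, n = (a.+1 + m)%N by exists (n - k.-1)%N; lia.
have {}sle : (s * 2 <= a.+1 * (a + m) + m * (a.+1 + (a.+2 * a.+1 + 1) * b))%N.
  by move: sle; rewrite ka lb nm /= addKn muln2.
(* Twice the claimed bound exceeds the right-hand side of [sle] by exactly [a * b], that is
   [(k - 2) * (l - 1)]; this is the only nonlinear fact that [lra] must be given. *)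
have ab0 : 0 <= a%:R * b%:R :> rat by rewrite mulr_ge0.
have succQ i : i.+1%:R = i%:R + 1 :> rat by rewrite natr1.
move: sle; rewrite -(ler_nat rat) ka lb nm.
rewrite !(natrD, natrM) !(succQ a.+1, succQ a, succQ b).
lra.
Qed.
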